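(* Let $\{z^k\}_{k\in\mathbb N}=\{(x^k,u^k,y^k)\}_{k\in\mathbb N}$ be a Lagrangian sequence for problem (CM), with penalty parameters $\{\rho_k\}$, and assume that the multiplier sequence $\{y^k\}_{k\in\mathbb N}$ is bounded. Then there exists an index $k_{\rm statio}\in\mathbb N$ such that $\rho_k=\rho_{k_{\rm statio}}$ for all $k\ge k_{\rm statio}$. Moreover, for all $k\ge k_{\rm statio}$ we have $x^k\in\mathcal Z$, and there exists $\tau>0$ such that for all $k\ge k_{\rm statio}$ $$\tau\|x^{k+1}-x^k\|^2\le\mathcal E_{\beta_{k_{\rm statio}}}(x^k,u^k,y^k,x^{k-1})-\mathcal E_{\beta_{k_{\rm statio}}}(x^{k+1},u^{k+1},y^{k+1},x^k).$$
   Context: Problem (CM): minimize $f(x)=f_0(x)+h(F(x))$ over $x\in\mathbb R^n$, where $f_0:\mathbb R^n\to\mathbb R$ and $F:\mathbb R^n\to\mathbb R^m$ ($m\le n$) are continuously differentiable, and $h:\mathbb R^m\to(-\infty,+\infty]$ is proper and lower semicontinuous with $\operatorname{dom}h=\{u:h(u)<\infty\}$ nonempty and closed. $\nabla F(x)\in\mathbb R^{m\times n}$ is the Jacobian; $\|\cdot\|$ is the Euclidean norm (operator norm for matrices). $\partial$ and $\partial^\infty$ denote the limiting and the horizon subdifferential (Rockafellar–Wets). Augmented Lagrangian: for $\rho>0$, $\mathcal L^\sharp_\rho(x,u,y)=f_0(x)+h(u)+\langle y,F(x)-u\rangle+\frac\rho2\|F(x)-u\|^2$ on $\mathbb R^n\times\mathbb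 R^m\times\mathbb R^m$. Lyapunov function: for $\beta>0$, $\mathcal E_\beta(x,u,y,w)=\mathcal L^\sharp_\rho(x,u,y)+\beta\|x-w\|^2$, $w\in\mathbb R^n$; $\mathcal E_{\beta_k}$ is built with $\rho=\rho_k$. Standing assumptions. (Well-posedness) $\inf_{x,u}\mathcal L^\sharp_\rho(x,u,y)>-\infty$ for every fixed $y\in\mathbb R^m$ (and $\rho>0$). (Assumption 1) For every $x$ with $F(x)\in\operatorname{dom}h$: $\nabla F(x)^Ty=0$ and $y\in\partial^\infty h(F(x))$ imply $y=0$. (Assumption 2) A set $\mathcal Z\subset\mathbb R^n$ (an information zone) is given, i.e. for some $\bar d\in(0,+\infty]$, $\mathcal Z\supset\{x:\operatorname{dist}(F(x),\operatorname{dom}h)\le\bar d\}\supset\{x:F(x)\in\operatorname{dom}h\}$, and: (i) there is $\gamma>0$ with $\|\nabla F(x)^Tv\|\ge\gamma\|v\|$ for all $x\in\mathcal Z$, $v\in\mathbb R^m$; (ii) $\nabla F$ is $L(F)$-Lipschitz on $\mathcal Z$; (iii) $\nabla f_0$ is $L(f_0)$-Lipschitz on $\mathcal Z$. Algorithm ALBUM. A Lagrangian algorithmic map $\mathcal A_\rho$ is a (set-valued) map $(x,u,y)\mapsto\mathcal A_\rho(x,u,y)\subset\mathbb R^n\times\mathbb R^m$ for which there are constants $a,b>0$ (the same for all penalty parameters $\rho$ used) such that every $(x^+,u^+)\in\mathcal A_\rho(x,u,y)$ satisfies $\frac a2\|x^+-x\|^2+\mathcal L^\sharp_\rho(x^+,u^+,y)\le\mathcal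 L^\sharp_\rho(x,u,y)$ and $\|\nabla_x\mathcal L^\sharp_\rho(x^+,u^+,y)\|\le b\|x^+-x\|$. Fix $\delta,\rho_0>0$, $\tau\in(0,\frac a2)$, any $(x^0,u^0,y^0)$ and any $x^{-1}\in\mathbb R^n$. For $k=0,1,\dots$: (1) $(x^{k+1},u^{k+1})\in\mathcal A_{\rho_k}(x^k,u^k,y^k)$; (2) $y^{k+1}=y^k+\rho_k(F(x^{k+1})-u^{k+1})$; (3) set $\beta_k=\frac{2b^2}{\rho_k\gamma^2}$; if $x^{k+1}\notin\mathcal Z$ or $\tau\|x^{k+1}-x^k\|^2>\mathcal E_{\beta_k}(x^k,u^k,y^k,x^{k-1})-\mathcal E_{\beta_k}(x^{k+1},u^{k+1},y^{k+1},x^k)$, set $\rho_{k+1}=\rho_k+\delta$; otherwise $\rho_{k+1}=\rho_k$. Lagrangian sequence: a sequence $z^k=(x^k,u^k,y^k)$ generated by ALBUM such that (C1) $\frac a2\|x^{k+1}-x^k\|^2+\mathcal L^\sharp_{\rho_k}(x^{k+1},u^{k+1},y^k)\le\mathcal L^\sharp_{\rho_k}(x^k,u^k,y^k)$ for all $k\ge0$; (C2) $\|\nabla_x\mathcal L^\sharp_{\rho_k}(x^{k+1},u^{k+1},y^k)\|\le b\|x^{k+1}-x^k\|$ for all $k\ge0$; (C3) there is $c>0$ such that for all $k\ge0$ some $v^{k+1}\in\partial_u\mathcal L^\sharp_{\rho_k}(x^{k+1},u^{k+1},y^k)$ satisfies $\|v^{k+1}\|\le c\|x^{k+1}-x^k\|$;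 (C4) whenever a subsequence $\{u^k\}_{k\in\mathcal K}$ converges to some $\bar u$, $\limsup_{k\in\mathcal K}h(u^k)\le h(\bar u)$. *)

(* Defs.v *)
(* Vectors of R^n are row vectors 'rV[R]_n.  Limits, continuity and closedness
   use the library topology of 'rV[R]_n, which is the Euclidean topology.  The
   library norm `|x| on 'rV[R]_n is the sup norm, so the Euclidean norm is
   defined below and used in every norm inequality. *)
From HB Require Import structures.
From mathcomp Require Import all_boot all_order all_algebra.
From mathcomp Require Import all_classical all_reals all_analysis.

Set Implicit Arguments.
Unset Strict Implicit.
Unset Printing Implicit Defensive.

Import Order.TTheory GRing.Theory Num.Theory.
Import numFieldNormedType.Exports.

Local Open Scope classical_set_scope.
Local Open Scope ring_scope.

Definition dotv (R : realType) (n : nat) (x y : 'rV[R]_n) : R :=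
  \sum_(i < n) x 0 i * y 0 i.

Definition enorm (R : realType) (n : nat) (x : 'rV[R]_n) : R :=
  Num.sqrt (dotv x x).

(* In row-vector notation, A w is [w *m A^T] and A^T v is [v *m A]. *)
Definition opnorm (R : realType) (m n : nat) (A : 'M[R]_(m, n)) : R :=
  sup [set enorm (w *m A^T) | w in [set w : 'rV[R]_n | enorm w <= 1]].

(* The distance is +oo when D is empty. *)
Definition edistv (R : realType) (m : nat) (u : 'rV[R]_m) (D : set 'rV[R]_m)
    : \bar R :=
  ereal_inf [set (enorm (u - w))%:E | w in D].

Definition grad (R : realType) (n : nat) (f : 'rV[R]_n -> R) (x : 'rV[R]_n)
    : 'rV[R]_n :=
  \row_i 'D_(delta_mx 0 i) f x.

(* The library's [jacobian] acts on row vectors from the right, hence the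
   transpose: [nabla F x] i j is the j-th partial derivative of F_i at x. *)
Definition nabla (R : realType) (n m : nat) (F : 'rV[R]_n -> 'rV[R]_m)
    (x : 'rV[R]_n) : 'M[R]_(m, n) :=
  (jacobian F x)^T.

Definition dom (R : realType) (m : nat) (h : 'rV[R]_m -> \bar R)
    : set 'rV[R]_m :=
  [set u | (h u < +oo)%E].

(* h z >= h x + <v, z - x> + o(|z - x|), with the little-o written out. *)
Definition regular_subdifferential (R : realType) (m : nat)
    (h : 'rV[R]_m -> \bar R) (x : 'rV[R]_m) : set 'rV[R]_m :=
  [set v | h x \is a fin_num /\
     forall e : R, 0 < e -> \forall z \near x,
       (h x + (dotv v (z - x) - e * enorm (z - x))%:E <= h z)%E].

Definition subdifferential (R : realType) (m : nat)
    (h : 'rV[R]_m -> \bar R) (x : 'rV[R]_m) : set 'rV[R]_m :=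
  [set v | h x \is a fin_num /\
     exists xs vs : nat -> 'rV[R]_m,
       [/\ xs @ \oo --> x, (h \o xs) @ \oo --> h x,
           forall k, regular_subdifferential h (xs k) (vs k)
         & vs @ \oo --> v]].

Definition horizon_subdifferential (R : realType) (m : nat)
    (h : 'rV[R]_m -> \bar R) (x : 'rV[R]_m) : set 'rV[R]_m :=
  [set v | h x \is a fin_num /\
     exists (xs vs : nat -> 'rV[R]_m) (lam : nat -> R),
       [/\ xs @ \oo --> x, (h \o xs) @ \oo --> h x,
           forall k, regular_subdifferential h (xs k) (vs k),
           (forall k, 0 < lam k) /\ lam @ \oo --> (0 : R)
         & (fun k => lam k *: vs k) @ \oo --> v]].

Record CM_problem (R : realType) (n m : nat) (f0 : 'rV[R]_n -> R)
    (F : 'rV[R]_n -> 'rV[R]_m) (h : 'rV[R]_m -> \bar R) : Prop := {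
  CM_le : (m <= n)%N;
  CM_f0_diff : forall x, differentiable f0 x;
  CM_f0_C1 : continuous (grad f0);
  CM_F_diff : forall x, differentiable F x;
  CM_F_C1 : continuous (nabla F);
  CM_h_gtNy : forall u, (-oo < h u)%E;
  CM_h_lsc : lower_semicontinuous h;
  CM_dom_neq0 : dom h !=set0;
  CM_dom_closed : closed (dom h)
}.

Definition alag_smooth (R : realType) (n m : nat) (f0 : 'rV[R]_n -> R)
    (F : 'rV[R]_n -> 'rV[R]_m) (rho : R)
    (x : 'rV[R]_n) (u y : 'rV[R]_m) : R :=
  f0 x + dotv y (F x - u) + rho / 2 * enorm (F x - u) ^+ 2.

Definition alag (R : realType) (n m : nat) (f0 : 'rV[R]_n -> R)
    (F : 'rV[R]_n -> 'rV[R]_m) (h : 'rV[R]_m -> \bar R) (rho : R)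
    (x : 'rV[R]_n) (u y : 'rV[R]_m) : \bar R :=
  ((alag_smooth f0 F rho x u y)%:E + h u)%E.

(* The term h u of [alag] does not depend on x, so it does not contribute to
   the gradient in x. *)
Definition gradx_alag (R : realType) (n m : nat) (f0 : 'rV[R]_n -> R)
    (F : 'rV[R]_n -> 'rV[R]_m) (rho : R)
    (x : 'rV[R]_n) (u y : 'rV[R]_m) : 'rV[R]_n :=
  grad (fun x' => alag_smooth f0 F rho x' u y) x.

Definition subdiffu_alag (R : realType) (n m : nat) (f0 : 'rV[R]_n -> R)
    (F : 'rV[R]_n -> 'rV[R]_m) (h : 'rV[R]_m -> \bar R) (rho : R)
    (x : 'rV[R]_n) (u y : 'rV[R]_m) : set 'rV[R]_m :=
  subdifferential (fun u' => alag f0 F h rho x u' y) u.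

Definition lyapunov (R : realType) (n m : nat) (f0 : 'rV[R]_n -> R)
    (F : 'rV[R]_n -> 'rV[R]_m) (h : 'rV[R]_m -> \bar R) (rho beta : R)
    (x : 'rV[R]_n) (u y : 'rV[R]_m) (w : 'rV[R]_n) : \bar R :=
  (alag f0 F h rho x u y + (beta * enorm (x - w) ^+ 2)%:E)%E.

Definition well_posed (R : realType) (n m : nat) (f0 : 'rV[R]_n -> R)
    (F : 'rV[R]_n -> 'rV[R]_m) (h : 'rV[R]_m -> \bar R) : Prop :=
  forall (rho : R) (y : 'rV[R]_m), 0 < rho ->
    (-oo < ereal_inf [set alag f0 F h rho xu.1 xu.2 y
                     | xu in [set: 'rV[R]_n * 'rV[R]_m]])%E.

Definition constraint_qualification (R : realType) (n m : nat)
    (F : 'rV[R]_n -> 'rV[R]_m) (h : 'rV[R]_m -> \bar R) : Prop :=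
  forall x : 'rV[R]_n, dom h (F x) ->
    forall y : 'rV[R]_m, y *m nabla F x = 0 ->
      horizon_subdifferential h (F x) y -> y = 0.

Definition information_zone (R : realType) (n m : nat)
    (F : 'rV[R]_n -> 'rV[R]_m) (h : 'rV[R]_m -> \bar R)
    (Z : set 'rV[R]_n) : Prop :=
  exists d : \bar R, [/\ (0 < d)%E,
    [set x | (edistv (F x) (dom h) <= d)%E] `<=` Z
    & [set x | dom h (F x)] `<=` [set x | (edistv (F x) (dom h) <= d)%E]].

Record zone_regularity (R : realType) (n m : nat) (f0 : 'rV[R]_n -> R)
    (F : 'rV[R]_n -> 'rV[R]_m) (h : 'rV[R]_m -> \bar R)
    (Z : set 'rV[R]_n) (gamma LF Lf0 : R) : Prop := {
  zone_info : information_zone F h Z;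
  zone_gamma_gt0 : 0 < gamma;
  zone_LF_ge0 : 0 <= LF;
  zone_Lf0_ge0 : 0 <= Lf0;
  zone_nabla_lb : forall x (v : 'rV[R]_m), Z x ->
    gamma * enorm v <= enorm (v *m nabla F x);
  zone_nabla_lip : forall x x', Z x -> Z x' ->
    opnorm (nabla F x - nabla F x') <= LF * enorm (x - x');
  zone_grad_lip : forall x x', Z x -> Z x' ->
    enorm (grad f0 x - grad f0 x') <= Lf0 * enorm (x - x')
}.

Definition lagrangian_map (R : realType) (n m : nat) (f0 : 'rV[R]_n -> R)
    (F : 'rV[R]_n -> 'rV[R]_m) (h : 'rV[R]_m -> \bar R) (a b rho : R)
    (A : 'rV[R]_n -> 'rV[R]_m -> 'rV[R]_m -> set ('rV[R]_n * 'rV[R]_m))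
    : Prop :=
  forall x u y x1 u1, A x u y (x1, u1) ->
    ((a / 2 * enorm (x1 - x) ^+ 2)%:E + alag f0 F h rho x1 u1 y
       <= alag f0 F h rho x u y)%E /\
    enorm (gradx_alag f0 F rho x1 u1 y) <= b * enorm (x1 - x).

Definition beta_of (R : realType) (b gamma rho : R) : R :=
  2 * b ^+ 2 / (rho * gamma ^+ 2).

(* x^{k-1}, where [xm1] stands for x^{-1}. *)
Definition xpred (R : realType) (n : nat) (xm1 : 'rV[R]_n)
    (x : nat -> 'rV[R]_n) (k : nat) : 'rV[R]_n :=
  if k is j.+1 then x j else xm1.

(* E_beta(x^k, u^k, y^k, x^{k-1}) - E_beta(x^{k+1}, u^{k+1}, y^{k+1}, x^k) *)
Definition lyapunov_decrease (R : realType) (n m : nat) (f0 : 'rV[R]_n -> R)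
    (F : 'rV[R]_n -> 'rV[R]_m) (h : 'rV[R]_m -> \bar R) (rho beta : R)
    (xm1 : 'rV[R]_n) (x : nat -> 'rV[R]_n) (u y : nat -> 'rV[R]_m)
    (k : nat) : \bar R :=
  (lyapunov f0 F h rho beta (x k) (u k) (y k) (xpred xm1 x k)
   - lyapunov f0 F h rho beta (x k.+1) (u k.+1) (y k.+1) (x k))%E.

(* Membership of each map in the class of Lagrangian algorithmic maps is
   required only at the penalty parameters rho_k that are used. *)
Record ALBUM (R : realType) (n m : nat) (f0 : 'rV[R]_n -> R)
    (F : 'rV[R]_n -> 'rV[R]_m) (h : 'rV[R]_m -> \bar R)
    (Z : set 'rV[R]_n) (gamma a b delta rho0 tau : R)
    (A : R -> 'rV[R]_n -> 'rV[R]_m -> 'rV[R]_m -> set ('rV[R]_n * 'rV[R]_m))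
    (xm1 : 'rV[R]_n) (x : nat -> 'rV[R]_n) (u y : nat -> 'rV[R]_m)
    (rho : nat -> R) : Prop := {
  ALBUM_a_gt0 : 0 < a;
  ALBUM_b_gt0 : 0 < b;
  ALBUM_delta_gt0 : 0 < delta;
  ALBUM_rho0_gt0 : 0 < rho0;
  ALBUM_tau : 0 < tau < a / 2;
  ALBUM_map : forall k, lagrangian_map f0 F h a b (rho k) (A (rho k));
  ALBUM_init : rho 0%N = rho0;
  ALBUM_primal : forall k, A (rho k) (x k) (u k) (y k) (x k.+1, u k.+1);
  ALBUM_dual : forall k, y k.+1 = y k + rho k *: (F (x k.+1) - u k.+1);
  ALBUM_penalty : forall k,
    rho k.+1 =
      if `[< ~ Z (x k.+1) \/
             ((tau * enorm (x k.+1 - x k) ^+ 2)%:E >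
               lyapunov_decrease f0 F h (rho k) (beta_of b gamma (rho k))
                 xm1 x u y k)%E >]
      then rho k + delta else rho k
}.

Record lagrangian_sequence (R : realType) (n m : nat) (f0 : 'rV[R]_n -> R)
    (F : 'rV[R]_n -> 'rV[R]_m) (h : 'rV[R]_m -> \bar R)
    (Z : set 'rV[R]_n) (gamma a b delta rho0 tau : R)
    (A : R -> 'rV[R]_n -> 'rV[R]_m -> 'rV[R]_m -> set ('rV[R]_n * 'rV[R]_m))
    (xm1 : 'rV[R]_n) (x : nat -> 'rV[R]_n) (u y : nat -> 'rV[R]_m)
    (rho : nat -> R) : Prop := {
  lagseq_ALBUM : ALBUM f0 F h Z gamma a b delta rho0 tau A xm1 x u y rho;
  lagseq_C1 : forall k,
    ((a / 2 * enorm (x k.+1 - x k) ^+ 2)%:E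
       + alag f0 F h (rho k) (x k.+1) (u k.+1) (y k)
     <= alag f0 F h (rho k) (x k) (u k) (y k))%E;
  lagseq_C2 : forall k,
    enorm (gradx_alag f0 F (rho k) (x k.+1) (u k.+1) (y k))
      <= b * enorm (x k.+1 - x k);
  lagseq_C3 : exists c : R, 0 < c /\ forall k,
    exists v : 'rV[R]_m,
      subdiffu_alag f0 F h (rho k) (x k.+1) (u k.+1) (y k) v /\
      enorm v <= c * enorm (x k.+1 - x k);
  lagseq_C4 : forall (s : nat -> nat) (ubar : 'rV[R]_m),
    {homo s : i j / (i < j)%N} -> (u \o s) @ \oo --> ubar ->
    (limn_esup (h \o u \o s) <= h ubar)%E
}.

(* Main.v *)
(* With y^{k+1} = y^k + rho_k (F(x^{k+1}) - u^{k+1}), the gradient in (C2) is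
   grad f0(x^{k+1}) + nabla F(x^{k+1})^T y^{k+1}.  Subtracting two consecutive
   ones and using the uniform lower bound gamma on nabla F^T bounds
   gamma |y^{k+1} - y^k| by (b + L) |x^{k+1} - x^k| + b |x^k - x^{k-1}|, with
   L = L(f0) + L(F) sup_k |y^k|.  The multiplier update raises the augmented
   Lagrangian by |y^{k+1} - y^k|^2 / rho_k, so for rho_k large the decrease (C1)
   absorbs it, the previous step being paid for by the beta_k term.  Moreover
   |F(x^{k+1}) - u^{k+1}| <= 2 sup_k |y^k| / rho_k with u^{k+1} in dom h, which
   puts x^{k+1} in the information zone.  Hence large penalties are never
   increased, and since each increase adds delta, there are finitely many. *)
Require Import Defs.
From HB Require Import structures.
From mathcomp Require Import all_boot all_order all_algebra.
From mathcomp Require Import all_classical all_reals all_analysis.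
From mathcomp Require Import ring lra.

Set Implicit Arguments.
Unset Strict Implicit.
Unset Printing Implicit Defensive.

Import Order.TTheory GRing.Theory Num.Theory.
Import numFieldNormedType.Exports.

Local Open Scope classical_set_scope.
Local Open Scope ring_scope.

(** * Euclidean inner product, norm and operator norm *)

Section Euclidean.
Context {R : realType}.

Lemma dotvC n (x y : 'rV[R]_n) : dotv x y = dotv y x.
Proof. by apply: eq_bigr => i _; rewrite mulrC. Qed.

Lemma dotvDl n (x y z : 'rV[R]_n) : dotv (x + y) z = dotv x z + dotv y z.
Proof. by rewrite -big_split; apply: eq_bigr => i _; rewrite mxE mulrDl. Qed.

Lemma dotvZl n c (x z : 'rV[R]_n) : dotv (c *: x) z = c * dotv x z.
Proof. by rewrite mulr_sumr; apply: eq_bigr => i _; rewrite mxE mulrA. Qed.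

Lemma dotvDr n (x y z : 'rV[R]_n) : dotv z (x + y) = dotv z x + dotv z y.
Proof. by rewrite dotvC dotvDl !(dotvC z). Qed.

Lemma dotvZr n c (x z : 'rV[R]_n) : dotv z (c *: x) = c * dotv z x.
Proof. by rewrite dotvC dotvZl dotvC. Qed.

Lemma dotv_ge0 n (x : 'rV[R]_n) : 0 <= dotv x x.
Proof. by apply: sumr_ge0 => i _; rewrite -expr2 sqr_ge0. Qed.

Lemma dotv_mulmx n m (v : 'rV[R]_m) (A : 'M[R]_(m, n)) (w : 'rV[R]_n) :
  dotv (v *m A) w = dotv v (w *m A^T).
Proof.
have dotvE p (x y : 'rV[R]_p) : dotv x y = (x *m y^T) 0 0.
  by rewrite mxE; apply: eq_bigr => i _; rewrite mxE.
by rewrite !dotvE trmx_mul trmxK mulmxA.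
Qed.

Lemma enorm_ge0 n (x : 'rV[R]_n) : 0 <= enorm x.
Proof. exact: sqrtr_ge0. Qed.

Lemma enorm_sqr n (x : 'rV[R]_n) : enorm x ^+ 2 = dotv x x.
Proof. by rewrite sqr_sqrtr // dotv_ge0. Qed.

Lemma enorm_eq0 n (x : 'rV[R]_n) : enorm x = 0 -> x = 0.
Proof.
move=> x0; have /eqP : dotv x x = 0 by rewrite -enorm_sqr x0 expr0n.
rewrite psumr_eq0 => [/allP x0'|i _]; last by rewrite -expr2 sqr_ge0.
apply/rowP => i; have := x0' i (mem_index_enum i).
by rewrite -expr2 sqrf_eq0 mxE => /eqP.
Qed.

Lemma enormZ n c (x : 'rV[R]_n) : enorm (c *: x) = `|c| * enorm x.
Proof.
by rewrite /enorm dotvZl dotvZr mulrA -expr2 sqrtrM ?sqr_ge0 // sqrtr_sqr.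
Qed.

Lemma enormN n (x : 'rV[R]_n) : enorm (- x) = enorm x.
Proof. by rewrite -scaleN1r enormZ normrN1 mul1r. Qed.

Lemma dotv0l n (x : 'rV[R]_n) : dotv 0 x = 0.
Proof. by apply: big1 => i _; rewrite mxE mul0r. Qed.

Lemma dotv_le_enorm n (x y : 'rV[R]_n) : dotv x y <= enorm x * enorm y.
Proof.
have [x0|x_neq0] := eqVneq (enorm x) 0.
  by rewrite x0 (enorm_eq0 x0) dotv0l mul0r.
have [y0|y_neq0] := eqVneq (enorm y) 0.
  by rewrite y0 (enorm_eq0 y0) dotvC dotv0l mulr0.
have x_gt0 : 0 < enorm x by rewrite lt_def x_neq0 enorm_ge0.
have y_gt0 : 0 < enorm y by rewrite lt_def y_neq0 enorm_ge0.
(* Cauchy-Schwarz: this square expands to [2 |x| |y| (|x| |y| - <x, y>)], whose first factor is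
   positive. *)
have := dotv_ge0 (enorm y *: x + (- enorm x) *: y).
rewrite !(dotvDl, dotvDr) !(dotvZl, dotvZr) (dotvC y x) -!enorm_sqr => xy_ge0.
rewrite -(ler_pM2l (mulr_gt0 x_gt0 y_gt0)).
nra.
Qed.

Lemma enormD n (x y : 'rV[R]_n) : enorm (x + y) <= enorm x + enorm y.
Proof.
rewrite -(@ler_pXn2r _ 2) ?nnegrE ?addr_ge0 ?enorm_ge0 //.
rewrite enorm_sqr !(dotvDl, dotvDr) (dotvC y x) -!enorm_sqr.
have := dotv_le_enorm x y; nra.
Qed.

Lemma enormB n (x y : 'rV[R]_n) : enorm (x - y) <= enorm x + enorm y.
Proof. by rewrite -(enormN y) enormD. Qed.

(** Coordinates of [w *m A^T] are inner products with rows of [A], so the Frobenius norm is a bound.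
    This makes the [sup] in [opnorm] a true upper bound. *)
Lemma opnorm_has_ubound n m (A : 'M[R]_(m, n)) :
  has_ubound [set enorm (w *m A^T) | w in [set w : 'rV[R]_n | enorm w <= 1]].
Proof.
exists (Num.sqrt (\sum_i enorm (row i A) ^+ 2)) => _ [w /= w1 <-].
rewrite ler_wsqrtr //; apply: ler_sum => i _.
have -> : (w *m A^T) 0 i = dotv w (row i A).
  by rewrite mxE; apply: eq_bigr => j _; rewrite !mxE.
have rowA_ge0 := enorm_ge0 (row i A); have w_ge0 := enorm_ge0 w.
have := dotv_le_enorm w (row i A).
(* Using [- w] too bounds the inner product from both sides, hence its square. *)
have := dotv_le_enorm (- w) (row i A).
rewrite enormN -scaleN1r dotvZl mulN1r.
set s := dotv _ _ => h1 h2.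
have wA : enorm w * enorm (row i A) <= enorm (row i A).
  by rewrite ler_piMl.
nra.
Qed.

Lemma enorm_mulmx_tr_le n m (A : 'M[R]_(m, n)) (w : 'rV[R]_n) :
  enorm (w *m A^T) <= opnorm A * enorm w.
Proof.
have [w0|w_neq0] := eqVneq (enorm w) 0.
  by rewrite w0 (enorm_eq0 w0) mul0mx /enorm dotv0l sqrtr0 mulr0.
have w_gt0 : 0 < enorm w by rewrite lt_def w_neq0 enorm_ge0.
rewrite -ler_pdivrMr // mulrC -[X in X * _]ger0_norm ?invr_ge0 ?enorm_ge0 //.
rewrite -enormZ scalemxAl; apply: ub_le_sup; first exact: opnorm_has_ubound.
exists ((enorm w)^-1 *: w) => //=.
by rewrite enormZ ger0_norm ?invr_ge0 ?enorm_ge0 // mulVf.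
Qed.

(* |v A|^2 = <v, (v A) A^T>, so the bound on A transfers to its transpose. *)
Lemma enorm_mulmx_le n m (A : 'M[R]_(m, n)) (v : 'rV[R]_m) :
  enorm (v *m A) <= opnorm A * enorm v.
Proof.
have [vA0|vA_neq0] := eqVneq (enorm (v *m A)) 0.
  (* [opnorm A] is nonnegative because the unit ball contains [0]. *)
  rewrite vA0 mulr_ge0 ?enorm_ge0 //.
  apply: le_trans (enorm_ge0 (0 *m A^T)) _.
  apply: ub_le_sup; first exact: opnorm_has_ubound.
  by exists 0; rewrite //= /enorm dotv0l sqrtr0.
have vA_gt0 : 0 < enorm (v *m A) by rewrite lt_def vA_neq0 enorm_ge0.
rewrite -(ler_pM2r vA_gt0) -expr2 enorm_sqr dotv_mulmx.
apply: le_trans (dotv_le_enorm _ _) _.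
rewrite mulrAC mulrC ler_wpM2r ?enorm_ge0 //; exact: enorm_mulmx_tr_le.
Qed.

End Euclidean.

(** * Gradient of the augmented Lagrangian in [x] *)

Lemma mulmx_nablaE (R : realType) n m (F : 'rV[R]_n -> 'rV[R]_m) x
    (w : 'rV[R]_m) j :
  differentiable F x ->
  (w *m nabla F x) 0 j = \sum_i w 0 i * 'D_(delta_mx 0 j) (fun t => F t 0 i) x.
Proof.
move=> dF; rewrite mxE; apply: eq_bigr => i _; congr (_ * _).
have := deriveEjacobian (delta_mx 0 j) dF.
rewrite derive_mx; last exact: diff_derivable.
move=> /(congr1 (fun A : 'rV__ => A 0 i)); rewrite -rowE !mxE => ->.
by [].
Qed.

Lemma gradx_alagE (R : realType) n m (f0 : 'rV[R]_n -> R)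
    (F : 'rV[R]_n -> 'rV[R]_m) rho x u y :
  differentiable f0 x -> differentiable F x ->
  gradx_alag f0 F rho x u y =
    grad f0 x + (y + rho *: (F x - u)) *m nabla F x.
Proof.
move=> df0 dF; apply/rowP => j; rewrite [RHS]mxE mulmx_nablaE //.
rewrite /gradx_alag /grad !mxE.
set e := delta_mx 0 j.
have dFi i : is_derive x e (fun t => F t 0 i) ('D_e (fun t => F t 0 i) x).
  apply: derivableP.
  by have /derivable_mxP := diff_derivable (v := e) dF; apply.
have df0' : is_derive x e f0 ('D_e f0 x).
  by apply: derivableP; exact: diff_derivable.
pose G i := fun t => F t 0 i.
(* Coordinatewise form built from sums, scalings and powers of functions, so that one [is_derive]
   term computes the derivative. *)
have -> : (fun x' => alag_smooth f0 F rho x' u y) =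
    f0 + \sum_(i < m) (y 0 i \*: (G i - cst (u 0 i)))
    + (rho / 2) \*: \sum_(i < m) (G i - cst (u 0 i)) ^+ 2.
  apply/funext => t; rewrite /alag_smooth enorm_sqr /dotv !fctE !fct_sumE.
  congr (_ + _ + _ * _); apply: eq_bigr => i _; rewrite !mxE //.
rewrite (@derive_val _ _ _ _ _ _ _ (is_deriveD (is_deriveD df0'
  (is_derive_sum (fun i => is_deriveZ (y 0 i)
    (is_deriveB (dFi i) (is_derive_cst (u 0 i) x e)))))
  (is_deriveZ (rho / 2) (is_derive_sum (fun i => is_deriveX 2
    (is_deriveB (dFi i) (is_derive_cst (u 0 i) x e))))))).
rewrite -addrA; congr (_ + _).
rewrite scaler_sumr -big_split; apply: eq_bigr => i _ /=.
rewrite !mxE !fctE /= subr0 expr1 /GRing.scale /=.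
by field.
Qed.

(** * Finiteness of the number of penalty increases *)

Lemma bounded_steps_stationary (R : realType) (r : nat -> R) (d B : R) :
  0 < d -> (forall k, r k.+1 = r k \/ r k.+1 = r k + d) ->
  (forall k, r k < B) ->
  exists K, forall k, (K <= k)%N -> r k = r K.
Proof.
move=> d0 step ltB; apply: contrapT => /forallNP nstat.
(* Without stationarity, some later value differs from [r K]; as steps only add [0] or [d], it is at
   least [d] higher. *)
have jump K : exists k, r K + d <= r k.
  have /existsNP[k] := nstat K => /not_implyP[Kk rkK]; exists k.
  suff : r k = r K \/ r K + d <= r k by case.
  elim: k Kk {rkK} => [|k IH]; first by rewrite leqn0 => /eqP ->; left.
  rewrite leq_eqVlt => /predU1P[<-|Kk]; first by left.
  have := IH Kk; case: (step k) => ->; first by [].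
  case=> [->|rk]; right; first by [].
  by apply: le_trans rk _; rewrite lerDl ltW.
have large N : exists k, r 0%N + d *+ N <= r k.
  elim: N => [|N [k IH]]; first by exists 0%N; rewrite mulr0n addr0.
  have [l kl] := jump k; exists l; apply: le_trans kl.
  by rewrite mulrSr addrA lerD2r.
(* Enough jumps to exceed [B], by the Archimedean property. *)
have [k] := large (Num.bound ((B - r 0%N) / d)).
have Br0 : 0 < B - r 0%N by rewrite subr_gt0 ltB.
have := archi_boundP (divr_ge0 (ltW Br0) (ltW d0)).
rewrite ltr_pdivrMr // mulr_natl => h1 h2.
by have := ltB k; lra.
Qed.

(** * Estimates for one iteration *)

Lemma alag_dual_update (R : realType) n m (f0 : 'rV[R]_n -> R)
    (F : 'rV[R]_n -> 'rV[R]_m) rho x u y y1 :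
  0 < rho -> y1 = y + rho *: (F x - u) ->
  alag_smooth f0 F rho x u y1 =
    alag_smooth f0 F rho x u y + enorm (y1 - y) ^+ 2 / rho.
Proof.
move=> rho0 ->; rewrite [X in enorm X ^+ 2 / _]addrAC subrr add0r.
rewrite enormZ gtr0_norm // exprMn.
(* The added term [<y1 - y, F x - u>] is [rho |F x - u|^2]. *)
rewrite /alag_smooth dotvDl dotvZl -enorm_sqr.
by field; rewrite gt_eqF.
Qed.

Lemma information_zone_near_dom (R : realType) n m (F : 'rV[R]_n -> 'rV[R]_m)
    (h : 'rV[R]_m -> \bar R) (Z : set 'rV[R]_n) :
  information_zone F h Z ->
  exists2 d, 0 < d & forall x u, dom h u -> enorm (F x - u) <= d -> Z x.
Proof.
move=> [dbar [dbar_gt0 domZ _]].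
(* The radius [dbar] may be [+oo]; any positive real below it will do. *)
have [d d_gt0 d_le] : exists2 d : R, 0 < d & (d%:E <= dbar)%E.
  case: dbar dbar_gt0 {domZ} => [d|_|//]; first by rewrite lte_fin; exists d.
  by exists 1; rewrite ?ltr01 ?leey.
exists d => // x u hu Fxu; apply: domZ => /=.
apply: le_trans d_le; apply: le_trans (_ : ((enorm (F x - u))%:E <= _)%E).
  by apply: ereal_inf_lbound; exists u.
by rewrite lee_fin.
Qed.

Lemma multiplier_step_le (R : realType) n m (f0 : 'rV[R]_n -> R)
    (F : 'rV[R]_n -> 'rV[R]_m) (h : 'rV[R]_m -> \bar R) (Z : set 'rV[R]_n)
    (gamma LF Lf0 : R) x x1 (y y1 : 'rV[R]_m) :
  zone_regularity f0 F h Z gamma LF Lf0 -> Z x -> Z x1 ->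
  gamma * enorm (y1 - y) <=
    enorm (grad f0 x1 + y1 *m nabla F x1) + enorm (grad f0 x + y *m nabla F x)
    + (Lf0 + LF * enorm y) * enorm (x1 - x).
Proof.
move=> hzone Zx Zx1; apply: le_trans (zone_nabla_lb hzone _ Zx1) _.
(* Two optimality residuals minus a Lipschitz remainder; the Jacobian difference meets only the old
   multiplier [y]. *)
have -> : (y1 - y) *m nabla F x1 =
    (grad f0 x1 + y1 *m nabla F x1) - (grad f0 x + y *m nabla F x)
    - ((grad f0 x1 - grad f0 x) + y *m (nabla F x1 - nabla F x)).
  rewrite mulmxBl mulmxBr.
  move: (nabla F x1) (nabla F x) (grad f0 x1) (grad f0 x) => A1 A g1 g.
  move: (y1 *m A1) (y *m A1) (y *m A) => p q r.
  by apply/rowP => i; rewrite !mxE; ring.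
apply: le_trans (enormB _ _) _; apply: lerD; first exact: enormB.
apply: le_trans (enormD _ _) _; rewrite mulrDl; apply: lerD.
  exact: (zone_grad_lip hzone).
apply: le_trans (enorm_mulmx_le _ _) _; rewrite mulrAC ler_wpM2r ?enorm_ge0 //.
exact: (zone_nabla_lip hzone).
Qed.

(** Here [d0], [d1] are the previous and current step lengths and [D] the multiplier change.
    Squaring its bound leaves [2 b^2 / (rho gamma^2)] on [d0 ^+ 2], exactly [beta_of b gamma rho];
    the condition on [rho] absorbs the [d1 ^+ 2] terms. *)
Lemma descent_arith (R : realType) (a b gamma rho L tau d0 d1 D S0 S1 : R) :
  0 < rho -> 0 < gamma -> 0 <= D ->
  gamma * D <= (b + L) * d1 + b * d0 ->
  a / 2 * d1 ^+ 2 + S1 <= S0 ->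
  2 * (b + L) ^+ 2 + 2 * b ^+ 2 <= (a / 2 - tau) * (rho * gamma ^+ 2) ->
  tau * d1 ^+ 2 <= S0 + beta_of b gamma rho * d0 ^+ 2
    - (S1 + D ^+ 2 / rho + beta_of b gamma rho * d1 ^+ 2).
Proof.
move=> rho0 gamma0 D0 hD hS hrho.
have den0 : 0 < rho * gamma ^+ 2 by rewrite mulr_gt0 ?exprn_gt0.
have D2 : D ^+ 2 / rho <=
    (2 * (b + L) ^+ 2 * d1 ^+ 2 + 2 * b ^+ 2 * d0 ^+ 2) / (rho * gamma ^+ 2).
  rewrite ler_pdivlMr //.
  have -> : D ^+ 2 / rho * (rho * gamma ^+ 2) = (gamma * D) ^+ 2.
    by field; rewrite gt_eqF.
  have gD0 : 0 <= gamma * D by rewrite mulr_ge0 // ltW.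
  apply: (@le_trans _ _ (((b + L) * d1 + b * d0) ^+ 2)).
    by rewrite lerXn2r ?nnegrE ?(le_trans gD0).
  (* This is [(p + q)^2 <= 2 p^2 + 2 q^2]. *)
  have := sqr_ge0 ((b + L) * d1 - b * d0); lra.
have hd1 : (2 * (b + L) ^+ 2 + 2 * b ^+ 2) / (rho * gamma ^+ 2) * d1 ^+ 2
    <= (a / 2 - tau) * d1 ^+ 2.
  by rewrite ler_wpM2r ?sqr_ge0 // ler_pdivrMr.
rewrite /beta_of; move: D2 hd1; rewrite !mulrDl; set e := (rho * gamma ^+ 2)^-1.
lra.
Qed.

(** * Stabilization of the penalty and Lyapunov decrease *)

Theorem lemma4p4 (R : realType) (n m : nat)
    (f0 : 'rV[R]_n -> R) (F : 'rV[R]_n -> 'rV[R]_m) (h : 'rV[R]_m -> \bar R)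
    (Z : set 'rV[R]_n) (gamma LF Lf0 : R)
    (a b delta rho0 tau0 : R)
    (A : R -> 'rV[R]_n -> 'rV[R]_m -> 'rV[R]_m -> set ('rV[R]_n * 'rV[R]_m))
    (xm1 : 'rV[R]_n) (x : nat -> 'rV[R]_n) (u y : nat -> 'rV[R]_m)
    (rho : nat -> R)
    (hCM : CM_problem f0 F h)
    (hwp : well_posed f0 F h)
    (hcq : constraint_qualification F h)
    (hzone : zone_regularity f0 F h Z gamma LF Lf0)
    (hseq : lagrangian_sequence f0 F h Z gamma a b delta rho0 tau0
              A xm1 x u y rho)
    (hbnd : exists M : R, forall k, enorm (y k) <= M) :
  exists kstatio : nat,
    [/\ forall k, (kstatio <= k)%N -> rho k = rho kstatio,
        forall k, (kstatio <= k)%N -> Z (x k)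
      & exists tau : R, 0 < tau /\
          forall k, (kstatio <= k)%N ->
            ((tau * enorm (x k.+1 - x k) ^+ 2)%:E <=
              lyapunov_decrease f0 F h (rho kstatio)
                (beta_of b gamma (rho kstatio)) xm1 x u y k)%E].
Proof.
have [[a_gt0 b_gt0 delta_gt0 rho0_gt0 /andP[tau_gt0 tau_lt] _ rho_init _ dual
  penalty] C1 C2 [c [_ C3]] _] := hseq.
have [M yM] := hbnd.
have M_ge0 : 0 <= M := le_trans (enorm_ge0 (y 0%N)) (yM 0%N).
have gamma_gt0 := zone_gamma_gt0 hzone.
pose test k := ~ Z (x k.+1) \/
  ((tau0 * enorm (x k.+1 - x k) ^+ 2)%:E >
    lyapunov_decrease f0 F h (rho k) (beta_of b gamma (rho k)) xm1 x u y k)%E.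
have rho_step k : rho k.+1 = rho k \/ rho k.+1 = rho k + delta.
  by rewrite penalty; case: ifP => _; [right|left].
have rho_mono k l : (k <= l)%N -> rho k <= rho l.
  elim: l => [|l IH]; first by rewrite leqn0 => /eqP ->.
  rewrite leq_eqVlt => /predU1P[<-//|/IH /le_trans]; apply.
  by case: (rho_step l) => -> //; rewrite lerDl ltW.
have rho_gt0 k : 0 < rho k.
  by apply: lt_le_trans (rho_mono _ _ (leq0n k)); rewrite rho_init.
(* A limiting subgradient from (C3) exists only at a finite value; this covers [u k.+1], while
   [h (u 0)] may be infinite. *)
have h_fin k : h (u k.+1) \is a fin_num.
  have [v [[+ _] _]] := C3 k.
  by rewrite /alag fin_numD => /andP[].
have [d d_gt0 nearZ] := information_zone_near_dom (zone_info hzone).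
have inZ k : 2 * M / d <= rho k -> Z (x k.+1).
  move=> rho_large; apply: (nearZ _ (u k.+1)).
    by rewrite /dom /= ltey_eq h_fin.
  rewrite -(ler_pM2l (rho_gt0 k)) -[X in X * enorm _]gtr0_norm // -enormZ.
  have -> : rho k *: (F (x k.+1) - u k.+1) = y k.+1 - y k.
    by rewrite dual addrAC subrr add0r.
  rewrite ler_pdivrMr // in rho_large; apply: le_trans rho_large.
  by apply: le_trans (enormB _ _) _; rewrite mulr2n mulrDl !mul1r lerD.
pose L := Lf0 + LF * M.
have optimality k :
    enorm (grad f0 (x k.+1) + y k.+1 *m nabla F (x k.+1))
      <= b * enorm (x k.+1 - x k).
  rewrite dual -gradx_alagE ?C2 //; [exact: (CM_f0_diff hCM)|].
  exact: (CM_F_diff hCM).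
(* Starts at index [k.+1] because the multiplier bound compares optimality at two consecutive
   iterates, both in [Z]. *)
have descent k : Z (x k.+1) -> Z (x k.+2) ->
    2 * (b + L) ^+ 2 + 2 * b ^+ 2
      <= (a / 2 - tau0) * (rho k.+1 * gamma ^+ 2) ->
    ((tau0 * enorm (x k.+2 - x k.+1) ^+ 2)%:E <=
      lyapunov_decrease f0 F h (rho k.+1) (beta_of b gamma (rho k.+1))
        xm1 x u y k.+1)%E.
  move=> Zx Zx1 rho_large; rewrite /lyapunov_decrease /lyapunov /alag /=.
  have := C1 k.+1; rewrite /alag -(fineK (h_fin k)) -(fineK (h_fin k.+1)).
  rewrite -!EFinD !lee_fin => C1k.
  rewrite (alag_dual_update f0 (rho_gt0 k.+1) (dual k.+1)).
  rewrite [X in _ <= _ - (X + _)]addrAC.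
  apply: (descent_arith (rho_gt0 k.+1) gamma_gt0 (enorm_ge0 _) _ C1k rho_large).
  apply: le_trans (multiplier_step_le _ _ hzone Zx Zx1) _.
  rewrite (mulrDl b) [leRHS]addrAC; apply: lerD; first exact: lerD.
  by rewrite ler_wpM2r ?enorm_ge0 // lerD2l ler_wpM2l ?(zone_LF_ge0 hzone).
have [K stat] : exists K, forall k, (K <= k)%N -> rho k = rho K.
  (* Smallest penalty satisfying the condition of [descent_arith]. Either some [rho K] passes both
     thresholds, or [rho] is bounded. *)
  pose r1 := (2 * (b + L) ^+ 2 + 2 * b ^+ 2) / ((a / 2 - tau0) * gamma ^+ 2).
  have [[K]|/forallNP small] :=
    pselect (exists K, Num.max (2 * M / d) r1 <= rho K).
    (* The shift to [K.+1] ensures that the iterate before the tested one was also produced with a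
       large penalty. *)
    rewrite ge_max => /andP[KZ Kr]; exists K.+1.
    elim=> [//|k IH]; rewrite leq_eqVlt => /predU1P[<-//|Kk].
    rewrite -(IH Kk) penalty; case: asboolP => // -[].
      by case; apply: inZ; apply: le_trans KZ (rho_mono _ _ _); exact: ltnW.
    case: k {IH} Kk => // k; rewrite !ltnS => Kk.
    rewrite ltNge descent //.
    - by apply: inZ; apply: le_trans KZ (rho_mono _ _ Kk).
    - by apply: inZ; apply: le_trans KZ (rho_mono _ _ (leqW Kk)).
    - rewrite [leRHS]mulrCA -ler_pdivrMr ?mulr_gt0 ?exprn_gt0 ?subr_gt0 //.
      by apply: le_trans Kr (rho_mono _ _ (leqW Kk)).
  apply: (bounded_steps_stationary (B := Num.max (2 * M / d) r1) delta_gt0).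
    exact: rho_step.
  by move=> k; rewrite ltNge; apply/negP; exact: small.
(* A constant penalty means the test failed, since [delta] is nonzero. *)
have accepted k : (K <= k)%N -> ~ test k.
  move=> Kk; have := penalty k; rewrite (stat _ Kk) (stat _ (leqW Kk)).
  rewrite -(stat _ Kk); case: asboolP => // _ /eqP.
  by rewrite -subr_eq0 opprD addNKr oppr_eq0 gt_eqF.
have statE k : (K.+1 <= k)%N -> rho k = rho K.+1.
  by move=> Kk; rewrite (stat k (ltnW Kk)) (stat K.+1 (leqnSn K)).
(* A failed test at [k] places [x k.+1] in [Z], hence the shift by one. *)
exists K.+1; split => //.
- by case=> // k Kk; apply: contrapT => nZ; apply: (accepted k) => //; left.
- exists tau0; split => // k Kk; rewrite -(statE k Kk) leNgt; apply/negP => lt.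
  by apply: (accepted k (ltnW Kk)); right.
Qed.
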